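(* Let $R$ be a commutative artinian ring and let $\Theta=\{\Theta(1),\Theta(2),\dots,\Theta(n)\}$ be a family of objects in an artin extriangulated $R$-category $(\mathcal C,\mathbb E,\mathfrak s)$ such that $\mathbb E(\Theta(j),\Theta(i))=0$ for all $j\ge i$. Then the class $\mathcal P(\Theta)$ of the $\Theta$-projective objects is a precovering class in $\mathcal C$ and the class $\mathcal I(\Theta)$ of the $\Theta$-injective objects is a preenveloping class in $\mathcal C$.
   Context: **Extriangulated categories (Nakaoka–Palu).** Let $\mathcal C$ be an additive category and $\mathbb E:\mathcal C^{\mathrm{op}}\times\mathcal C\to \mathrm{Ab}$ a biadditive functor. An element $\delta\in\mathbb E(C,A)$ is an $\mathbb E$-extension; for $a:A\to A'$ and $c:C'\to C$ write $a_*\delta=\mathbb E(C,a)(\delta)$, $c^*\delta=\mathbb E(c,A)(\delta)$. For $\delta\in\mathbb E(C,A)$, $\delta'\in\mathbb E(C',A')$, a morphism $(a,c):\delta\to\delta'$ is a pair $a:A\to A'$, $c:C\to C'$ with $a_*\delta=c^*\delta'$; $\delta\oplus\delta'\in\mathbb E(C\oplus C',A\oplus A')$ is the element with components $(\delta,0,0,\delta')$ in $\mathbb E(C,A)\oplus\mathbb E(C,A')\oplus\mathbb E(C',A)\oplus\mathbb E(C',A')$. Sequences $A\xrightarrow{x}B\xrightarrow{y}C$ and $A\xrightarrow{x'}B'\xrightarrow{y'}C$ are equivalent if there is an isomorphism $b:B\to B'$ with $bx=x'$, $y'b=y$; $[A\to B\to C]$ denotes the equivalence class. A realization $\mathfrak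 s$ assigns to each $\delta\in\mathbb E(C,A)$ a class $\mathfrak s(\delta)=[A\xrightarrow{x}B\xrightarrow{y}C]$ such that for every morphism $(a,c):\delta\to\delta'$, with $\mathfrak s(\delta')=[A'\xrightarrow{x'}B'\xrightarrow{y'}C']$, there is $b:B\to B'$ with $bx=x'a$, $y'b=cy$. It is additive if $\mathfrak s(0)=[A\to A\oplus C\to C]$ (canonical maps) and $\mathfrak s(\delta\oplus\delta')=\mathfrak s(\delta)\oplus\mathfrak s(\delta')$. $(\mathcal C,\mathbb E,\mathfrak s)$ is an extriangulated category if: (ET1) $\mathbb E$ is biadditive; (ET2) $\mathfrak s$ is an additive realization; (ET3) if $\mathfrak s(\delta)=[A\xrightarrow{x}B\xrightarrow{y}C]$, $\mathfrak s(\delta')=[A'\xrightarrow{x'}B'\xrightarrow{y'}C']$ and $bx=x'a$, then there is $c:C\to C'$ with $(a,c):\delta\to\delta'$ a morphism and $cy=y'b$; (ET4) if $\delta\in\mathbb E(D,A)$, $\delta'\in\mathbb E(F,B)$ are realized by $A\xrightarrow{f}B\xrightarrow{f'}D$ and $B\xrightarrow{g}C\xrightarrow{g'}F$, there are an object $E$, morphisms $h=gf:A\to C$, $h':C\to E$, $d:D\to E$, $e:E\to F$ with $h'g=df'$, $eh'=g'$, and $\delta''\in\mathbb E(E,A)$ realized by $A\xrightarrow{h}C\xrightarrow{h'}E$, such that $D\xrightarrow{d}E\xrightarrow{e}F$ realizes $f'_*\delta'$, $d^*\delta''=\delta$ and $f_*\delta''=e^*\delta'$; and (ET3)$^{\mathrm{op}}$,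 (ET4)$^{\mathrm{op}}$, the duals of (ET3), (ET4) (obtained by passing to the opposite category). An $\mathbb E$-triangle $A\to B\to C\dashrightarrow$ is a sequence realizing some $\delta\in\mathbb E(C,A)$. **Artin extriangulated $R$-category.** An extriangulated category which is an $R$-category (Hom sets are $R$-modules, composition is $R$-bilinear), with $\mathbb E$ an $R$-bilinear functor into $R$-modules, such that all $\mathrm{Hom}_{\mathcal C}(X,Y)$ and all $\mathbb E(X,Y)$ are finitely generated $R$-modules, and $\mathcal C$ is Krull–Schmidt (every object is a finite direct sum of objects with local endomorphism rings). **Filtered objects.** For a class $\mathcal X$ of objects, $\mathfrak F(\mathcal X)$ is the class of objects $M$ admitting an $\mathcal X$-filtration: a family of $\mathbb E$-triangles $\{M_{i-1}\to M_i\to X_i\dashrightarrow\}_{i=0}^{m}$ with $M_{-1}=0=X_0$, $M_m=M$ and $X_i\in\mathcal X$ for $i\ge1$. **$\Theta$-projectives and $\Theta$-injectives.** $\mathcal P(\Theta):=\{A\in\mathcal C\mid \mathbb E(A,X)=0\text{ for all }X\in\mathfrak F(\Theta)\}$ and $\mathcal I(\Theta):=\{A\in\mathcal C\mid \mathbb E(X,A)=0\text{ for all }X\in\mathfrak F(\Theta)\}$. **Precovering, preenveloping.** An $\mathcal X$-precover of $C$ is a morphism $f:X\to C$ with $X\in\mathcal X$ such that $\mathrm{Hom}_{\mathcal C}(X',X)\to\mathrm{Hom}_{\mathcal C}(X',C)$ is surjective for all $X'\in\mathcal X$; $\mathcal X$ is precovering in $\mathcal C$ if every object of $\mathcal C$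 has an $\mathcal X$-precover. $\mathcal X$-preenvelopes and preenveloping classes are defined dually. *)

(* Defs.v *)
From mathcomp Require Import all_boot all_order all_algebra.

Set Implicit Arguments.
Unset Strict Implicit.
Unset Printing Implicit Defensive.

Import GRing.Theory.
Local Open Scope ring_scope.

Declare Scope cat_scope.
Delimit Scope cat_scope with cat.
Reserved Notation "g \oc f" (at level 40, left associativity).
Reserved Notation "A \(+) B" (at level 50, left associativity).

(** [comPzRingType] is the MathComp structure of commutative rings in which
    1 = 0 is allowed. *)

Definition is_ideal (R : comPzRingType) (I : R -> Prop) : Prop :=
  [/\ I 0, forall x y, I x -> I y -> I (x + y)
    & forall a x, I x -> I (a * x)].

Definition artinian (R : comPzRingType) : Prop :=
  forall I : nat -> R -> Prop,
    (forall k, is_ideal (I k)) ->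
    (forall k x, I k.+1 x -> I k x) ->
    exists N, forall k, (N <= k)%N -> forall x, I k x <-> I N x.

Definition fin_gen (R : comPzRingType) (M : lmodType R) : Prop :=
  exists (k : nat) (g : 'I_k -> M),
    forall m : M, exists c : 'I_k -> R, m = \sum_(i < k) c i *: g i.

(** The zero object and the biproducts [dsum] are a choice, made as part of the
    data; up to isomorphism, nothing below depends on it. *)

Record addCat (R : comPzRingType) := AddCat {
  obj :> Type;
  mor : obj -> obj -> lmodType R;
  id_mor : forall A, mor A A;
  comp_mor : forall A B D, mor B D -> mor A B -> mor A D;
  comp_mor1 : forall A B (f : mor A B), comp_mor f (id_mor A) = f;
  comp1_mor : forall A B (f : mor A B), comp_mor (id_mor B) f = f;
  comp_morA : forall A B D F (h : mor D F) (g : mor B D) (f : mor A B),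
    comp_mor h (comp_mor g f) = comp_mor (comp_mor h g) f;
  comp_mor_linl : forall A B D (f : mor A B),
    linear (fun g : mor B D => comp_mor g f);
  comp_mor_linr : forall A B D (g : mor B D),
    linear (fun f : mor A B => comp_mor g f);
  zobj : obj;
  zobj_terminal : forall A (f : mor A zobj), f = 0;
  zobj_initial : forall A (f : mor zobj A), f = 0;
  dsum : obj -> obj -> obj;
  in1 : forall A B, mor A (dsum A B);
  in2 : forall A B, mor B (dsum A B);
  pr1 : forall A B, mor (dsum A B) A;
  pr2 : forall A B, mor (dsum A B) B;
  pr1_in1 : forall A B, comp_mor (pr1 A B) (in1 A B) = id_mor A;
  pr2_in2 : forall A B, comp_mor (pr2 A B) (in2 A B) = id_mor B;
  pr1_in2 : forall A B, comp_mor (pr1 A B) (in2 A B) = 0;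
  pr2_in1 : forall A B, comp_mor (pr2 A B) (in1 A B) = 0;
  in_pr : forall A B,
    comp_mor (in1 A B) (pr1 A B) + comp_mor (in2 A B) (pr2 A B)
      = id_mor (dsum A B)
}.

Arguments id_mor {R a} A.
Arguments zobj {R} a.
Arguments in1 {R a} A B.
Arguments in2 {R a} A B.
Arguments pr1 {R a} A B.
Arguments pr2 {R a} A B.

Notation "g \oc f" := (comp_mor g f) : cat_scope.
Notation "A \(+) B" := (dsum A B) : cat_scope.
Local Open Scope cat_scope.

Section CategoryNotions.
Variables (R : comPzRingType) (CC : addCat R).
Implicit Types A B C D X Y : CC.

Definition is_iso A B (f : mor A B) : Prop :=
  exists g : mor B A, g \oc f = id_mor A /\ f \oc g = id_mor B.

Definition zero_object Z : Prop :=
  (forall A (f : mor A Z), f = 0) /\ (forall A (f : mor Z A), f = 0).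

Definition msum A B A' B' (f : mor A B) (f' : mor A' B') :
    mor (A \(+) A') (B \(+) B') :=
  in1 B B' \oc f \oc pr1 A A' + in2 B B' \oc f' \oc pr2 A A'.

Definition left_ideal_End X (I : mor X X -> Prop) : Prop :=
  [/\ I 0, forall f g, I f -> I g -> I (f + g)
    & forall g f, I f -> I (g \oc f)].

Definition max_left_ideal_End X (I : mor X X -> Prop) : Prop :=
  [/\ left_ideal_End I, ~ I (id_mor X)
    & forall J : mor X X -> Prop, left_ideal_End J ->
        (forall f, I f -> J f) -> ~ J (id_mor X) -> forall f, J f -> I f].

(** A ring is local if it has exactly one maximal left ideal. *)
Definition local_End X : Prop :=
  exists2 I : mor X X -> Prop, max_left_ideal_End I
    & forall J, max_left_ideal_End J -> forall f, J f <-> I f.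

Definition krull_schmidt : Prop :=
  forall X, exists (k : nat) (Y : 'I_k -> CC),
    (forall i, local_End (Y i)) /\
    exists f : mor X (\big[@dsum R CC/zobj CC]_(i < k) Y i), is_iso f.

Definition precover (P : CC -> Prop) X C (f : mor X C) : Prop :=
  P X /\ forall X' (g : mor X' C), P X' -> exists h : mor X' X, f \oc h = g.

Definition precovering (P : CC -> Prop) : Prop :=
  forall C, exists X (f : mor X C), precover P f.

Definition preenvelope (P : CC -> Prop) C X (f : mor C X) : Prop :=
  P X /\ forall X' (g : mor C X'), P X' -> exists h : mor X X', h \oc f = g.

Definition preenveloping (P : CC -> Prop) : Prop :=
  forall C, exists X (f : mor C X), preenvelope P f.

Record sequence A C := Sequence {
  mid : CC;
  fst_mor : mor A mid;
  snd_mor : mor mid C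
}.

Definition seq_equiv A C (S S' : sequence A C) : Prop :=
  exists2 b : mor (mid S) (mid S'), is_iso b
    & b \oc fst_mor S = fst_mor S' /\ snd_mor S' \oc b = snd_mor S.

End CategoryNotions.

(** R-bilinear functors CC^op x CC -> Mod R.  The element
    [push a d] is a_* d and [pull c d] is c^* d. *)

Record bifunctor (R : comPzRingType) (CC : addCat R) := Bifunctor {
  ext :> CC -> CC -> lmodType R;
  push : forall C A A', mor A A' -> ext C A -> ext C A';
  pull : forall C C' A, mor C' C -> ext C A -> ext C' A;
  push1 : forall C A (d : ext C A), push (id_mor A) d = d;
  pull1 : forall C A (d : ext C A), pull (id_mor C) d = d;
  push_comp : forall C A A' A'' (a' : mor A' A'') (a : mor A A') (d : ext C A),
    push (a' \oc a) d = push a' (push a d);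
  pull_comp : forall C C' C'' A (c : mor C' C) (c' : mor C'' C') (d : ext C A),
    pull (c \oc c') d = pull c' (pull c d);
  push_pull : forall C C' A A' (a : mor A A') (c : mor C' C) (d : ext C A),
    push a (pull c d) = pull c (push a d);
  push_lin : forall C A A' (a : mor A A'), linear (@push C A A' a);
  pull_lin : forall C C' A (c : mor C' C), linear (@pull C C' A c);
  push_linm : forall C A A' (d : ext C A),
    linear (fun a : mor A A' => push a d);
  pull_linm : forall C C' A (d : ext C A),
    linear (fun c : mor C' C => pull c d)
}.

Section Extriangulated.
Variables (R : comPzRingType) (CC : addCat R) (EE : bifunctor CC).

Definition ext_mor A C A' C' (d : EE C A) (d' : EE C' A')
    (a : mor A A') (c : mor C C') : Prop := push a d = pull c d'.

(** The extension with components (d, 0, 0, d'); see [ext_dsumP]. *)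
Definition ext_dsum A C A' C' (d : EE C A) (d' : EE C' A') :
    EE (C \(+) C') (A \(+) A') :=
  push (in1 A A') (pull (pr1 C C') d) + push (in2 A A') (pull (pr2 C C') d').

Let pushD C A A' (a : mor A A') (u v : EE C A) :
  push a (u + v) = push a u + push a v.
Proof. by have := push_lin a 1 u v; rewrite !scale1r. Qed.

Let pullD C C' A (c : mor C' C) (u v : EE C A) :
  pull c (u + v) = pull c u + pull c v.
Proof. by have := pull_lin c 1 u v; rewrite !scale1r. Qed.

Let push0 C A A' (a : mor A A') : push a (0 : EE C A) = 0.
Proof. by apply: (addIr (push a 0)); rewrite -pushD !add0r. Qed.

Let pull0 C C' A (c : mor C' C) : pull c (0 : EE C A) = 0.
Proof. by apply: (addIr (pull c 0)); rewrite -pullD !add0r. Qed.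

Let push0m C A A' (d : EE C A) : push (0 : mor A A') d = 0.
Proof.
apply: (addIr (push 0 d)); have := @push_linm R CC EE C A A' d 1 0 0.
by rewrite /= !scale1r !add0r.
Qed.

Let pull0m C C' A (d : EE C A) : pull (0 : mor C' C) d = 0.
Proof.
apply: (addIr (pull 0 d)); have := @pull_linm R CC EE C C' A d 1 0 0.
by rewrite /= !scale1r !add0r.
Qed.

Let pushDm C A A' (a b : mor A A') (d : EE C A) :
  push (a + b) d = push a d + push b d.
Proof. by have := @push_linm R CC EE C A A' d 1 a b; rewrite /= !scale1r. Qed.

Let pullDm C C' A (a b : mor C' C) (d : EE C A) :
  pull (a + b) d = pull a d + pull b d.
Proof. by have := @pull_linm R CC EE C C' A d 1 a b; rewrite /= !scale1r. Qed.

Lemma ext_dsumP A C A' C' (d : EE C A) (d' : EE C' A')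
    (w : EE (C \(+) C') (A \(+) A')) :
  w = ext_dsum d d' <->
  [/\ pull (in1 C C') (push (pr1 A A') w) = d,
      pull (in1 C C') (push (pr2 A A') w) = 0,
      pull (in2 C C') (push (pr1 A A') w) = 0
    & pull (in2 C C') (push (pr2 A A') w) = d'].
Proof.
split=> [->|[w11 w12 w21 w22]].
  rewrite /ext_dsum; split; rewrite pushD -!push_comp ?pr1_in1 ?pr1_in2
    ?pr2_in1 ?pr2_in2 ?push1 ?push0m ?addr0 ?add0r -?pull_comp ?pr1_in1
    ?pr1_in2 ?pr2_in1 ?pr2_in2 ?pull1 ?pull0m //.
rewrite -[w]push1 -in_pr pushDm /ext_dsum !push_comp.
have split1 X (u : EE (C \(+) C') X) :
    u = pull (pr1 C C') (pull (in1 C C') u)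
        + pull (pr2 C C') (pull (in2 C C') u).
  by rewrite -!pull_comp -pullDm in_pr pull1.
rewrite [push (pr1 A A') w]split1 [push (pr2 A A') w]split1 w11 w12 w21 w22.
by rewrite !pull0 addr0 add0r.
Qed.

(** [s d] is a class of sequences; [s d S] reads "S realizes d". *)
Definition class_assignment : Type :=
  forall C A : CC, EE C A -> sequence A C -> Prop.

Definition realizes (s : class_assignment) (A B C : CC)
    (x : mor A B) (y : mor B C) (d : EE C A) : Prop :=
  s C A d (Sequence x y).

Definition is_class_assignment (s : class_assignment) : Prop :=
  forall C A (d : EE C A), exists S0 : sequence A C,
    forall S, s C A d S <-> seq_equiv S0 S.

Definition is_realization (s : class_assignment) : Prop :=
  is_class_assignment s /\
  forall A B C A' B' C' (d : EE C A) (d' : EE C' A')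
    (x : mor A B) (y : mor B C) (x' : mor A' B') (y' : mor B' C')
    (a : mor A A') (c : mor C C'),
    realizes s x y d -> realizes s x' y' d' -> ext_mor d d' a c ->
    exists b : mor B B', b \oc x = x' \oc a /\ y' \oc b = c \oc y.

Definition additive_realization (s : class_assignment) : Prop :=
  [/\ is_realization s,
      forall A C, realizes s (in1 A C) (pr2 A C) (0 : EE C A)
    & forall A B C A' B' C' (d : EE C A) (d' : EE C' A')
        (x : mor A B) (y : mor B C) (x' : mor A' B') (y' : mor B' C'),
        realizes s x y d -> realizes s x' y' d' ->
        realizes s (msum x x') (msum y y') (ext_dsum d d')].

Definition ET3 (s : class_assignment) : Prop :=
  forall A B C A' B' C' (d : EE C A) (d' : EE C' A')
    (x : mor A B) (y : mor B C) (x' : mor A' B') (y' : mor B' C')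
    (a : mor A A') (b : mor B B'),
    realizes s x y d -> realizes s x' y' d' -> b \oc x = x' \oc a ->
    exists c : mor C C', ext_mor d d' a c /\ c \oc y = y' \oc b.

Definition ET4 (s : class_assignment) : Prop :=
  forall A B C D F (d1 : EE D A) (d2 : EE F B)
    (f : mor A B) (f' : mor B D) (g : mor B C) (g' : mor C F),
    realizes s f f' d1 -> realizes s g g' d2 ->
    exists (E : CC) (h' : mor C E) (d : mor D E) (e : mor E F) (d3 : EE E A),
      (h' \oc g = d \oc f' /\ e \oc h' = g') /\
      [/\ realizes s (g \oc f) h' d3,
          realizes s d e (push f' d2),
          pull d d3 = d1
        & push f d3 = pull e d2].

End Extriangulated.

Section Opposite.
Variables (R : comPzRingType) (CC : addCat R).

Definition op_cat : addCat R :=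
  @AddCat R CC (fun A B => mor B A) (@id_mor R CC)
    (fun A B D g f => f \oc g)
    (fun A B f => comp1_mor f) (fun A B f => comp_mor1 f)
    (fun A B D F h g f => esym (comp_morA f g h))
    (fun A B D f => @comp_mor_linr R CC D B A f)
    (fun A B D g => @comp_mor_linl R CC D B A g)
    (zobj CC) (@zobj_initial R CC) (@zobj_terminal R CC)
    (@dsum R CC) (@pr1 R CC) (@pr2 R CC) (@in1 R CC) (@in2 R CC)
    (@pr1_in1 R CC) (@pr2_in2 R CC) (@pr2_in1 R CC) (@pr1_in2 R CC)
    (@in_pr R CC).

Definition op_bifunctor (EE : bifunctor CC) : bifunctor op_cat :=
  @Bifunctor R op_cat (fun C A => EE A C)
    (fun C A A' a d => @pull R CC EE A A' C a d)
    (fun C C' A c d => @push R CC EE A C C' c d)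
    (fun C A d => @pull1 R CC EE A C d) (fun C A d => @push1 R CC EE A C d)
    (fun C A A' A'' a' a d => @pull_comp R CC EE A A' A'' C a a' d)
    (fun C C' C'' A c c' d => @push_comp R CC EE A C C' C'' c' c d)
    (fun C C' A A' a c d => esym (@push_pull R CC EE A A' C C' c a d))
    (fun C A A' a => @pull_lin R CC EE A A' C a)
    (fun C C' A c => @push_lin R CC EE A C C' c)
    (fun C A A' d => @pull_linm R CC EE A A' C d)
    (fun C C' A d => @push_linm R CC EE A C C' d).

(** The opposite of A -> B -> C is C -> B -> A, so that [S], a sequence from
    [A] to [C] in the opposite category, is read backwards in [CC]. *)
Definition op_assignment (EE : bifunctor CC) (s : class_assignment EE) :
    class_assignment (op_bifunctor EE) :=
  fun C A d S => @realizes R CC EE s C (mid S) A (snd_mor S) (fst_mor S) d.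

End Opposite.

(** (ET1) is built into [bifunctor]. *)
Record extriangulated (R : comPzRingType) (CC : addCat R) (EE : bifunctor CC)
    (s : class_assignment EE) : Prop := {
  et2 : additive_realization s;
  et3 : ET3 s;
  et3_op : ET3 (op_assignment s);
  et4 : ET4 s;
  et4_op : ET4 (op_assignment s)
}.

Record artin_extriangulated (R : comPzRingType) (CC : addCat R)
    (EE : bifunctor CC) (s : class_assignment EE) : Prop := {
  artin_extri : extriangulated s;
  artin_mor_fg : forall X Y : CC, fin_gen (mor X Y);
  artin_ext_fg : forall X Y : CC, fin_gen (EE X Y);
  artin_krull_schmidt : krull_schmidt CC
}.

Section Theta.
Variables (R : comPzRingType) (CC : addCat R) (EE : bifunctor CC).
Variable s : class_assignment EE.

Definition triangle (A B C : CC) : Prop :=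
  exists (x : mor A B) (y : mor B C) (d : EE C A), realizes s x y d.

(** Indices are shifted by one: [N i] is the object M_(i-1) of the filtration
    and [X i] the object X_i; values outside the range are irrelevant. *)
Definition filtered (P : CC -> Prop) (M : CC) : Prop :=
  exists (m : nat) (N X : nat -> CC),
    [/\ zero_object (N 0%N), zero_object (X 0%N), N m.+1 = M,
        forall i, (0 < i <= m)%N -> P (X i)
      & forall i, (i <= m)%N -> triangle (N i) (N i.+1) (X i)].

Definition filt_family n (Theta : 'I_n -> CC) : CC -> Prop :=
  filtered (fun X => exists i, X = Theta i).

Definition Theta_projective n (Theta : 'I_n -> CC) (A : CC) : Prop :=
  forall X, filt_family Theta X -> forall d : EE A X, d = 0.

Definition Theta_injective n (Theta : 'I_n -> CC) (A : CC) : Prop :=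
  forall X, filt_family Theta X -> forall d : EE X A, d = 0.

End Theta.

(* Main.v *)
Require Import Defs.
From mathcomp Require Import all_boot all_order all_algebra.
Local Open Scope ring_scope.

(** Given an object X, the E-triangles X -> Y -> Theta(i) are used to kill one
    generator of E(Theta(i), X) at a time; since E(Theta(i), Theta(i)) = 0, no
    new elements of E(Theta(i), -) appear, so that finitely many steps suffice.
    Treating i = n, ..., 1 in this order, the vanishing of E(Theta(j), -)
    already achieved for j > i is preserved because E(Theta(j), Theta(i)) = 0.
    Every map from X to a Theta-injective object extends along each step, so the
    composite is a preenvelope.  The statement on Theta-projectives is the same
    one in the opposite category, with the order of Theta reversed. *)

Set Implicit Arguments.
Unset Strict Implicit.
Unset Printing Implicit Defensive.

Import GRing.Theory.
Local Open Scope cat_scope.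

(** * Symmetry of the biproduct and equivalence of sequences *)

Section Additive.
Variables (R : comPzRingType) (CC : addCat R).
Implicit Types A B C D : CC.

Lemma linear_map0 (U V : lmodType R) (f : U -> V) : linear f -> f 0 = 0.
Proof. by move=> /(_ (-1) 0 0); rewrite scaler0 addr0 scaleN1r addNr. Qed.

Lemma linear_mapD (U V : lmodType R) (f : U -> V) :
  linear f -> {morph f : u v / u + v}.
Proof. by move=> fL u v; have := fL 1 u v; rewrite !scale1r. Qed.

Lemma comp_mor0 A B C (g : mor B C) : g \oc (0 : mor A B) = 0.
Proof. exact: linear_map0 (@comp_mor_linr _ _ A B C g). Qed.

Lemma comp0_mor A B C (f : mor A B) : (0 : mor B C) \oc f = 0.
Proof. exact: linear_map0 (@comp_mor_linl _ _ A B C f). Qed.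

Lemma comp_morDr A B C (g : mor B C) (f f' : mor A B) :
  g \oc (f + f') = g \oc f + g \oc f'.
Proof. exact: linear_mapD (@comp_mor_linr _ _ A B C g) f f'. Qed.

Lemma comp_morDl A B C (f : mor A B) (g g' : mor B C) :
  (g + g') \oc f = g \oc f + g' \oc f.
Proof. exact: linear_mapD (@comp_mor_linl _ _ A B C f) g g'. Qed.

(** Passing to the opposite category puts the summands of a split sequence in the other order; this
    isomorphism compares the two. *)
Definition dswap A B : mor (A \(+) B) (B \(+) A) :=
  in2 B A \oc pr1 A B + in1 B A \oc pr2 A B.

Lemma dswap_in1 A B : dswap A B \oc in1 A B = in2 B A.
Proof.
by rewrite comp_morDl -!comp_morA pr1_in1 pr2_in1 comp_mor0 comp_mor1 addr0.
Qed.

Lemma dswap_in2 A B : dswap A B \oc in2 A B = in1 B A.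
Proof.
by rewrite comp_morDl -!comp_morA pr1_in2 pr2_in2 comp_mor0 comp_mor1 add0r.
Qed.

Lemma pr1_dswap A B : pr1 B A \oc dswap A B = pr2 A B.
Proof.
by rewrite comp_morDr !comp_morA pr1_in2 pr1_in1 comp0_mor comp1_mor add0r.
Qed.

Lemma dswapK A B : dswap B A \oc dswap A B = id_mor (A \(+) B).
Proof.
by rewrite {2}/dswap comp_morDr !comp_morA dswap_in2 dswap_in1 in_pr.
Qed.

Lemma seq_equiv_sym A C (S S' : sequence A C) :
  seq_equiv S S' -> seq_equiv S' S.
Proof.
case=> b [b' [b'b bb']] [bx yb]; exists b'; first by exists b.
by rewrite -bx -yb comp_morA b'b comp1_mor -comp_morA bb' comp_mor1.
Qed.

Lemma seq_equiv_trans A C (S S' S'' : sequence A C) :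
  seq_equiv S S' -> seq_equiv S' S'' -> seq_equiv S S''.
Proof.
case=> b [b' [b'b bb']] [bx yb] [c [c' [c'c cc']] [cx yc]].
exists (c \oc b); last by rewrite -comp_morA bx cx comp_morA yc yb.
exists (b' \oc c'); split.
  by rewrite comp_morA -(comp_morA b') c'c comp_mor1.
by rewrite comp_morA -(comp_morA c) bb' comp_mor1.
Qed.

Lemma zero_object_zobj : zero_object (zobj CC).
Proof. by split=> A f; [exact: zobj_terminal | exact: zobj_initial]. Qed.

End Additive.

(** * Split sequences, extension of maps and half-exactness *)

Section Extriangulated.
Variables (R : comPzRingType) (CC : addCat R) (EE : bifunctor CC).
Implicit Types A B C D T X Y Z : CC.

Lemma push0 C A A' (a : mor A A') : push a (0 : EE C A) = 0.
Proof. exact: linear_map0 (push_lin a). Qed.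

Lemma pull0 C C' A (c : mor C' C) : pull c (0 : EE C A) = 0.
Proof. exact: linear_map0 (pull_lin c). Qed.

Variable s : class_assignment EE.
Hypothesis sE : extriangulated s.

Let s_class : is_class_assignment s.
Proof. by case: (et2 sE) => [[]]. Qed.

Lemma realizes_ex C A (d : EE C A) :
  exists B (x : mor A B) (y : mor B C), realizes s x y d.
Proof.
have [[B x y] dS] := s_class d; exists B, x, y; apply/dS.
by exists (id_mor B); [exists (id_mor B)|]; rewrite /= ?comp1_mor ?comp_mor1.
Qed.

Lemma realizes_equiv C A (d : EE C A) (S S' : sequence A C) :
  s d S -> seq_equiv S S' -> s d S'.
Proof.
by have [S0 dS] := s_class d => /dS S0S SS'; apply/dS; apply: seq_equiv_trans SS'.
Qed.

(** When [A] is zero, [pr2 A C] is an isomorphism from the split sequence to this one. *)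
Lemma realizes_zero_object A C :
  zero_object A -> realizes s (0 : mor A C) (id_mor C) (0 : EE C A).
Proof.
case=> to0 from0; case: (et2 sE) => _ s0 _.
apply: realizes_equiv (s0 A C) _; exists (pr2 A C); last first.
  by rewrite /= pr2_in1 comp1_mor.
exists (in2 A C); split; last exact: pr2_in2.
by rewrite /= -in_pr (from0 _ (in1 A C)) comp0_mor add0r.
Qed.

Lemma realizes0_section A B C (x : mor A B) (y : mor B C) :
  realizes s x y 0 -> exists t : mor C B, y \oc t = id_mor C.
Proof.
move=> xy; case: (et2 sE) => [[_ s_mor] s0 _].
have [|b [_ yb]] := s_mor _ _ _ _ _ _ _ _ _ _ _ _ (id_mor A) (id_mor C)
  (s0 A C) xy; first by rewrite /ext_mor push1 pull1.
by exists (b \oc in2 A C); rewrite comp_morA yb comp1_mor pr2_in2.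
Qed.

Section Triangle.
Variables (A B C : CC) (x : mor A B) (y : mor B C) (d : EE C A).
Hypothesis xyd : realizes s x y d.

(** The hypothesis makes [(f, id)] a morphism from [d] to the split extension; its middle component
    followed by [pr1] extends [f]. *)
Lemma extend_along Z (f : mor A Z) :
  push f d = 0 -> exists g : mor B Z, g \oc x = f.
Proof.
move=> fd0; case: (et2 sE) => [[_ s_mor] s0 _].
have [|b [bx _]] := s_mor _ _ _ _ _ _ _ _ _ _ _ _ f (id_mor C) xyd (s0 Z C).
  by rewrite /ext_mor fd0 pull0.
by exists (pr1 Z C \oc b); rewrite -comp_morA bx comp_morA pr1_in1 comp1_mor.
Qed.

(* (ET3) applied to the map from the triangle to B = B -> 0. *)
Lemma push_realization : push x d = 0.
Proof.
case: (et2 sE) => _ s0 _.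
have [c [xd _]] := et3 sE (b := in1 B (zobj CC)) xyd (s0 B (zobj CC)) erefl.
by rewrite [LHS]xd pull0.
Qed.

(** (ET4) for [d] and [w] gives [d3] with [push x d3 = pull e w], where [e] is the deflation of a
    realization of [push y w = 0]. So [e] has a section [t], and pulling back along [t] leaves [w]
    on the right. *)
Lemma ext_exact_mid Z (w : EE Z B) :
  push y w = 0 -> exists v : EE Z A, push x v = w.
Proof.
move=> yw0; have [G [g [g' gw]]] := realizes_ex w.
have [E [h' [i [e [d3 [_ [_]]]]]]] := et4 sE xyd gw.
rewrite yw0 => /realizes0_section[t et] _ xd3.
by exists (pull t d3); rewrite push_pull xd3 -pull_comp et pull1.
Qed.

Lemma ext_mid_eq0 Z : (forall w : EE Z A, w = 0) -> (forall w : EE Z C, w = 0) ->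
  forall w : EE Z B, w = 0.
Proof.
move=> ZA0 ZC0 w; have [v <-] := ext_exact_mid (ZC0 (push y w)).
by rewrite (ZA0 v) push0.
Qed.

End Triangle.

Lemma extriangulated_op : extriangulated (op_assignment s).
Proof.
have [[s_cl s_mor] s0 s_sum] := et2 sE.
(* (ET3) and (ET4) trade places with their duals, the double opposite being convertible to [s]; only
   (ET2) needs an argument. *)
split; [split; [split| |] | exact: et3_op sE | exact: et3 sE
       | exact: et4_op sE | exact: et4 sE].
- move=> C A d; have [[B x y] dS] := s_cl _ _ d.
  exists (@Sequence _ (op_cat CC) A C B y x) => -[B' x' y'].
  by split=> [/dS/seq_equiv_sym[b [b' [? ?]] [/= bx yb]]
    | [b [b' [/= ? ?]] [/= bx yb]]];
    [exists b | apply/dS/seq_equiv_sym; exists b] => //; exists b'.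
- move=> A B C A' B' C' d d' x y x' y' a c xy xy' dd'.
  by have [|b [bx yb]] := s_mor _ _ _ _ _ _ _ _ _ _ _ _ c a xy' xy;
    [exact: esym dd' | exists b].
- move=> A C; apply: realizes_equiv (s0 C A) _.
  exists (@dswap R CC C A); first by exists (@dswap R CC A C); rewrite !dswapK.
  by rewrite /= dswap_in1 pr1_dswap.
- move=> A B C A' B' C' d d' x y x' y' xy xy'.
  have := s_sum _ _ _ _ _ _ _ _ _ _ _ _ xy xy'.
  by rewrite /realizes /ext_dsum /op_assignment /msum /= !push_pull !comp_morA.
Qed.

(** * Killing extensions and building the preenvelope *)

Lemma kill_ext T X : fin_gen (EE T X) -> (forall w : EE T T, w = 0) ->
  exists Y (f : mor X Y),
  [/\ forall w : EE T Y, w = 0,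
      forall I (g : mor X I), (forall w : EE T I, w = 0) ->
        exists h : mor Y I, h \oc f = g
    & forall Z, (forall w : EE Z X, w = 0) -> (forall w : EE Z T, w = 0) ->
        forall w : EE Z Y, w = 0].
Proof.
case=> k [g gen] T0; elim: k X g gen => [|k IHk] X g gen.
  exists X, (id_mor X); split=> // [w|I u _]; last by exists u; exact: comp_mor1.
  by have [c ->] := gen w; rewrite big_ord0.
have [Y [x [y xy]]] := realizes_ex (g ord_max).
(* [push x] maps E(T, X) onto E(T, Y) because E(T, T) = 0, and it kills the generator realized by
   the triangle, so the images of the other [k] generate E(T, Y). *)
have [w|Y' [f [Y'0 f_ext f_van]]] :=
  IHk Y (fun i => push x (g (widen_ord (leqnSn k) i))).
  have [v <-] := ext_exact_mid xy (T0 (push y w)).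
  have [c ->] := gen v; exists (fun i => c (widen_ord (leqnSn k) i)).
  have pushZ a (u : EE T X) : push x (a *: u) = a *: push x u.
    by have := push_lin x a u 0; rewrite push0 !addr0.
  rewrite (big_morph _ (linear_mapD (push_lin x)) (push0 T x)) big_ord_recr /=.
  rewrite pushZ (push_realization xy) scaler0 addr0.
  by apply: eq_bigr => i _; rewrite pushZ.
exists Y', (f \oc x); split=> // [I u I0 | Z ZX ZT].
  (* The obstruction to extending [u] along [x] lies in E(T, I) = 0. *)
  have [v <-] := extend_along xy (I0 (push u (g ord_max))).
  by have [h <-] := f_ext I v I0; exists h; rewrite comp_morA.
exact: f_van (ext_mid_eq0 xy ZX ZT) ZT.
Qed.

Lemma preenveloping_ext_orthogonal n (Theta : 'I_n -> CC) :
  (forall X Y, fin_gen (EE X Y)) ->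
  (forall i j : 'I_n, (i <= j)%N ->
     forall d : EE (Theta j) (Theta i), d = 0) ->
  preenveloping (fun A => forall i (d : EE (Theta i) A), d = 0).
Proof.
move=> fgE Theta0 C.
(* [m] counts the objects already treated, from the last index downwards; at [m = n] every index is
   covered. *)
suff /(_ n (leqnn n))[Y [f [Y0 f_ext]]] m : (m <= n)%N ->
    exists Y (f : mor C Y),
    (forall j : 'I_n, (n - m <= j)%N -> forall w : EE (Theta j) Y, w = 0) /\
    forall I (g : mor C I), (forall i (w : EE (Theta i) I), w = 0) ->
      exists h : mor Y I, h \oc f = g.
  by exists Y, f; split=> // i w; apply: Y0; rewrite subnn.
elim: m => [|m IHm] lt_mn.
  exists C, (id_mor C); split=> [j|I g _]; last by exists g; exact: comp_mor1.
  by rewrite subn0 leqNgt ltn_ord.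
have [Y [f [Y0 f_ext]]] := IHm (ltnW lt_mn).
have lt_i : (n - m.+1 < n)%N by rewrite ltn_subrL (leq_ltn_trans _ lt_mn).
pose i := Ordinal lt_i.
have [Y' [f' [Y'0 f'_ext f'_van]]] :=
  kill_ext (fgE (Theta i) Y) (Theta0 i i (leqnn i)).
exists Y', (f' \oc f); split=> [j|I g I0].
  rewrite leq_eqVlt => /orP[/eqP ij|lt_ij w].
    by have -> : j = i by apply: val_inj.
  apply: f'_van => [v|]; last exact: Theta0 i j (ltnW lt_ij).
  by apply: Y0; rewrite -subSS subSn.
have [h <-] := f_ext I g I0.
by have [h' <-] := f'_ext I h (I0 i); exists h'; rewrite comp_morA.
Qed.

Lemma filt_family_Theta n (Theta : 'I_n -> CC) i :
  filt_family s Theta (Theta i).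
Proof.
(* The filtration has [m = 1]: by the index shift [N 0] and [N 1] are M_(-1) = M_0 = 0 and [N 2] is
   M_1. Both triangles have the form 0 -> C = C. *)
pose N k : CC := if (k < 2)%N then zobj CC else Theta i.
pose X k : CC := if k is 0%N then zobj CC else Theta i.
exists 1%N, N, X; split; try exact: zero_object_zobj; first by [].
  by case=> // k _; exists i.
case=> [|[|]] // _; do 3 eexists; apply: realizes_zero_object;
  exact: zero_object_zobj.
Qed.

End Extriangulated.

(** * Reduction from filtered objects to the family itself *)

Section Theta.
Variables (R : comPzRingType) (CC : addCat R) (EE : bifunctor CC).
Variable s : class_assignment EE.
Hypothesis sE : extriangulated s.
Variables (n : nat) (Theta : 'I_n -> CC).

Lemma ext_zero_objectr (A Z : CC) (w : EE A Z) : zero_object Z -> w = 0.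
Proof.
case=> to0 _; rewrite -[w]push1 (to0 _ (id_mor Z)).
exact: linear_map0 (push_linm w).
Qed.

Lemma ext_zero_objectl (A Z : CC) (w : EE Z A) : zero_object Z -> w = 0.
Proof.
case=> to0 _; rewrite -[w]pull1 (to0 _ (id_mor Z)).
exact: linear_map0 (pull_linm w).
Qed.

(** Each member of the family is filtered; conversely, vanishing climbs a filtration by
    half-exactness of E(A, -). *)
Lemma Theta_projectiveP (A : CC) :
  Theta_projective s Theta A <-> forall i (d : EE A (Theta i)), d = 0.
Proof.
split=> [pA i|A0 X [m [N [Q [N0 Q0 <- QT tri]]]]].
  exact: pA (filt_family_Theta sE Theta i).
suff N_eq0 k : (k <= m.+1)%N -> forall d : EE A (N k), d = 0 by exact: N_eq0.
elim: k => [|k IHk] le_k d; first exact: ext_zero_objectr.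
have [x [y [w xyw]]] := tri k le_k.
apply: (ext_mid_eq0 sE xyw) => {}d; first exact: IHk (ltnW le_k) d.
(* The bottom factor [Q 0] is a zero object rather than a member of the family. *)
case: k le_k {IHk x y w xyw} d => [|k] le_k d; first exact: ext_zero_objectr.
by have [|i Qi] := QT k.+1; first exact: le_k; move: d; rewrite Qi.
Qed.

Lemma Theta_injectiveP (A : CC) :
  Theta_injective s Theta A <-> forall i (d : EE (Theta i) A), d = 0.
Proof.
split=> [pA i|A0 X [m [N [Q [N0 Q0 <- QT tri]]]]].
  exact: pA (filt_family_Theta sE Theta i).
suff N_eq0 k : (k <= m.+1)%N -> forall d : EE (N k) A, d = 0 by exact: N_eq0.
elim: k => [|k IHk] le_k d; first exact: ext_zero_objectl.
have [x [y [w xyw]]] := tri k le_k.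
(* Half-exactness of E(-, A) is that of the covariant functor in the opposite category, where the
   triangle is read backwards. *)
apply: (@ext_mid_eq0 _ _ _ _ (extriangulated_op sE) _ _ _ y x w xyw A) => {}d;
  last exact: IHk (ltnW le_k) d.
case: k le_k {IHk x y w xyw} d => [|k] le_k d; first exact: ext_zero_objectl.
by have [|i Qi] := QT k.+1; first exact: le_k; move: d => /=; rewrite Qi.
Qed.

End Theta.

Theorem theorem1p4 (R : comPzRingType) (CC : addCat R) (EE : bifunctor CC)
    (s : class_assignment EE) (n : nat) (Theta : 'I_n -> CC) :
  artinian R ->
  artin_extriangulated s ->
  (forall i j : 'I_n, (i <= j)%N ->
     forall d : EE (Theta j) (Theta i), d = 0) ->
  precovering (Theta_projective s Theta) /\
  preenveloping (Theta_injective s Theta).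
Proof.
move=> _ [sE _ fgE _] Theta0; split=> C.
  (* The opposite category swaps the arguments of E, so the vanishing hypothesis holds there only
     after [rev_ord] reverses the order of the indices. *)
  have [|X [f [X0 f_cov]]] := preenveloping_ext_orthogonal
    (extriangulated_op sE) (Theta := Theta \o @rev_ord n) (fun X Y => fgE Y X) _ C.
    by move=> i j le_ij d; apply: Theta0; rewrite /= leq_sub2l.
  exists X, f; split=> [|X' g /(Theta_projectiveP sE) X'0].
    by apply/(Theta_projectiveP sE) => i; rewrite -[i]rev_ordK; exact: X0.
  by apply: f_cov => i; exact: X'0.
have [X [f [X0 f_env]]] := preenveloping_ext_orthogonal sE fgE Theta0 C.
exists X, f; split=> [|X' g /(Theta_injectiveP sE)]; last exact: f_env.
exact/(Theta_injectiveP sE).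
Qed.
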